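(* Let $0\le d\le n$ be integers, let $\mathcal{H}$ be a $k$-uniform family of subsets of $[n]=\{1,\dots,n\}$ (i.e. $|F|=k$ for all $F\in\mathcal{H}$), and let $\mathbb{F}$ be a field. Suppose there exists a polynomial $P(\mathbf{x},\mathbf{y})\in\mathbb{F}[x_1,\dots,x_n,y_1,\dots,y_n]$ of total degree at most $d$ such that $P(\mathbf{v}_F,\mathbf{v}_F)\ne 0$ for every $F\in\mathcal{H}$ and $P(\mathbf{v}_F,\mathbf{v}_G)=0$ for all $F\ne G$ in $\mathcal{H}$. Then \[ |\mathcal{H}|\le 2\binom{n}{\lfloor d/2\rfloor}. \]
   Context: For $F\subseteq[n]$, $\mathbf{v}_F\in\{0,1\}^n\subseteq\mathbb{F}^n$ denotes the characteristic vector of $F$ (its $i$-th coordinate is $1$ iff $i\in F$). *)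

(* Defs.v *)
From HB Require Import structures.
From mathcomp Require Import all_boot all_order all_algebra.
From mathcomp Require Import mpoly.

Set Implicit Arguments.
Unset Strict Implicit.
Unset Printing Implicit Defensive.

Import GRing.Theory.
Local Open Scope ring_scope.

Definition charvec (F : fieldType) (n : nat) (A : {set 'I_n}) : 'I_n -> F :=
  fun i => (i \in A)%:R.

(* In {mpoly F[n + n]}, the first n indeterminates play the role of
   x_1, ..., x_n and the last n that of y_1, ..., y_n. *)
Definition eval2 (F : fieldType) (n : nat) (P : {mpoly F[n + n]})
    (x y : 'I_n -> F) : F :=
  P.@[fun i => match split i with inl j => x j | inr j => y j end].

(* Main.v *)
(** The matrix [P(v_A, v_B)], for [A] and [B] in [H], is diagonal with nonzero
    entries, so its rank is [#|H|]. With [e = d %/ 2], each monomial of [P] has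
    degree at most [e] in [x] or in [y], so the rank is at most twice the
    dimension of the span, as functions on [H], of the monomials
    [x_S = \prod_(i in S) x_i] with [#|S| <= e]. If [e <= k], this dimension is
    at most ['C(n, e)]: over the rationals each [x_S] is on the [k]-sets a
    combination of the [x_U] with [#|U| = e], and the rank of an integer matrix
    does not increase on passing from the rationals to another field. If
    [k < e <= n / 2], already [#|H| <= 'C(n, k) <= 'C(n, e)]. *)
Require Import Defs.
From HB Require Import structures.
From mathcomp Require Import all_boot all_order all_algebra.
From mathcomp Require Import mpoly zify.

Set Implicit Arguments.
Unset Strict Implicit.
Unset Printing Implicit Defensive.

Import GRing.Theory.
Local Open Scope ring_scope.

(** By [(j + 1) C(n, j + 1) = (n - j) C(n, j)], binomials do not decrease from [j] to [j + 1] while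
    [j + 1 <= n - j]. *)
Lemma leq_bin_half (n i j : nat) :
  (i <= j)%N -> (j.*2 <= n)%N -> ('C(n, i) <= 'C(n, j))%N.
Proof.
elim: j => [|j IHj]; first by rewrite leqn0 => /eqP->.
rewrite leq_eqVlt => /predU1P[-> //|lt_ij le_jn].
have le_jn' : (j.+1 <= n - j)%N by rewrite leq_subRL; move: le_jn; rewrite -addnn; lia.
apply: leq_trans (IHj _ _) _ => //; first by move: le_jn; rewrite -!addnn; lia.
by rewrite -(leq_pmul2l (ltn0Sn j)) mul_bin_left leq_mul2r le_jn' orbT.
Qed.

Lemma mxrank_rowsub (F : fieldType) (m n p : nat) (f : 'I_p -> 'I_m)
    (A : 'M[F]_(m, n)) :
  (\rank (rowsub f A) <= \rank A)%N.
Proof. by apply/mxrankS/row_subP => i; rewrite row_rowsub row_sub. Qed.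

Lemma mxrank_mxsub (F : fieldType) (m n p q : nat) (f : 'I_p -> 'I_m)
    (g : 'I_q -> 'I_n) (A : 'M[F]_(m, n)) :
  (\rank (mxsub f g A) <= \rank A)%N.
Proof.
have -> : mxsub f g A = rowsub f (rowsub g A^T)^T.
  by apply/matrixP => i j; rewrite !mxE.
apply: leq_trans (mxrank_rowsub _ _) _.
by rewrite mxrank_tr -(mxrank_tr A) mxrank_rowsub.
Qed.

(* A nonzero minor of maximal size over [F] is the image of an integer minor,
   which is then nonzero over the rationals. *)
Lemma mxrank_intr (F : fieldType) (m n : nat) (A : 'M[int]_(m, n)) :
  (\rank (map_mx (intr : int -> F) A) <= \rank (map_mx (intr : int -> rat) A))%N.
Proof.
set AF := map_mx _ A; set f := maxrankfun AF.
have full : row_full (rowsub f AF)^T.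
  by rewrite /row_full mxrank_tr -/(row_free _) maxrowsub_free.
set g := fullrankfun full.
have := fullrowsub_unit full; rewrite -/g => unitF.
have defF : rowsub g (rowsub f AF)^T = map_mx intr (mxsub f g A)^T.
  by apply/matrixP => i j; rewrite !mxE.
have detQ : map_mx (intr : int -> rat) (mxsub f g A)^T \in unitmx.
  move: unitF; rewrite defF !unitmxE !unitfE !det_map_mx.
  by rewrite intr_eq0; apply: contraNneq => ->.
rewrite -[X in (X <= _)%N](mxrank_unit detQ) -map_trmx mxrank_tr map_mxsub.
exact: mxrank_mxsub.
Qed.

Section Inclusion.

Variable T : finType.

(** These are the values of the monomial [x_S] at the characteristic vectors of the members of [H].
    The ring varies so that the same 0/1 matrix can be read over [int], [rat] and [F]. *)
Definition incl_row (R : nzSemiRingType) (H : {set {set T}}) (S : {set T}) :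
    'rV[R]_#|H| :=
  \row_(j < #|H|) (S \subset (enum_val j : {set T}))%:R.

Definition incl_mx (R : nzSemiRingType) (K H : {set {set T}}) :
    'M[R]_(#|K|, #|H|) :=
  \matrix_i incl_row R H (enum_val i).

Lemma incl_row_sub (F : fieldType) (K H : {set {set T}}) (S : {set T}) :
  S \in K -> (incl_row F H S <= incl_mx F K H)%MS.
Proof.
move=> KS; rewrite -(enum_rankK_in KS KS) -(rowK (fun i => incl_row F H (enum_val i))).
exact: row_sub.
Qed.

Lemma map_incl_mx (R S : nzRingType) (f : {rmorphism R -> S}) (K H : {set {set T}}) :
  map_mx f (incl_mx R K H) = incl_mx S K H.
Proof. by apply/matrixP => i j; rewrite !mxE rmorph_nat. Qed.

(** Adding [S] maps the subsets of [A :\: S] of size [e - #|S|] bijectively onto these sets;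
    removing [S] is the inverse. *)
Lemma card_interval (S A : {set T}) (e : nat) :
  S \subset A -> (#|S| <= e)%N ->
  #|[set U : {set T} | [&& S \subset U, U \subset A & #|U| == e]]| =
    'C(#|A| - #|S|, e - #|S|).
Proof.
move=> sSA le_Se; rewrite -cardsDS // -cards_draws.
rewrite -[RHS](card_in_imset (f := fun V => S :|: V)); last first.
  move=> V V'; rewrite !inE !subsetD => /andP[/andP[_ dV] _] /andP[/andP[_ dV'] _].
  move=> /(congr1 (fun X => X :\: S)); rewrite !setDUl setDv !set0U.
  by rewrite !(setDidPl _).
apply: eq_card => U; rewrite inE; apply/and3P/imsetP.
  case=> sSU sUA /eqP cU; exists (U :\: S); last by rewrite -{1}(setIidPr sSU) setID.
  by rewrite inE setSD //= cardsDS // cU.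
case=> V; rewrite inE subsetD => /andP[/andP[sVA dV] /eqP cV] ->.
rewrite subsetUl subUset sSA sVA cardsU (eqP (_ : S :&: V == set0)) ?cards0.
  by rewrite cV subn0 subnKC.
by rewrite setI_eq0 disjoint_sym.
Qed.

(* Over [rat], for [#|S| <= e <= k] the row of [S] is, up to the nonzero factor
   ['C(k - #|S|, e - #|S|)], the sum of the rows of the [e]-sets containing [S]. *)
Lemma mxrank_incl_rat (H : {set {set T}}) (e k : nat) :
  (forall A, A \in H -> #|A| = k) -> (e <= k)%N ->
  (\rank (incl_mx rat [set S : {set T} | #|S| <= e]%N H) <= 'C(#|T|, e))%N.
Proof.
move=> cH le_ek; rewrite -card_draws; set K := [set _ | _ == e].
apply: (leq_trans _ (rank_leq_row (incl_mx rat K H))).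
apply/mxrankS/row_subP => i; rewrite rowK.
have := enum_valP i; move: (enum_val i) => S; rewrite inE => le_Se.
set c := 'C(k - #|S|, e - #|S|).
(* [c] is positive because [e <= k], but it could vanish in positive characteristic. *)
have c_neq0 : c%:R != 0 :> rat.
  by rewrite Num.Theory.pnatr_eq0 -lt0n bin_gt0 leq_sub2r.
have -> : incl_row rat H S =
    c%:R^-1 *: \sum_(U in K | S \subset U) incl_row rat H U.
  apply/rowP => j; rewrite !mxE summxE.
  under eq_bigr do rewrite mxE.
  have cA := cH _ (enum_valP j); move: (enum_val j) cA => A cA.
  (* In the column of [A] the sum counts the [e]-sets between [S] and [A]: [c] of them if [S] lies
     in [A], none otherwise. *)
  have [sSA|nsSA] := boolP (S \subset A).
    rewrite -natr_sum -big_mkcondr /= sum1dep_card.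
    rewrite (_ : #|_| = c) ?mulVf // /c -cA -card_interval //.
    by apply: eq_card => U; rewrite !inE; case: (_ == e); rewrite ?andbF ?andbT.
  rewrite big1 ?mulr0 // => U /andP[_ sSU].
  by rewrite (negPf (contraNN (subset_trans sSU) nsSA)).
apply/scalemx_sub/summx_sub => U /andP[KU _]; exact: incl_row_sub.
Qed.

Lemma mxrank_incl (F : fieldType) (H : {set {set T}}) (e k : nat) :
  (forall A, A \in H -> #|A| = k) -> (e <= k)%N ->
  (\rank (incl_mx F [set S : {set T} | #|S| <= e]%N H) <= 'C(#|T|, e))%N.
Proof.
move=> cH le_ek; apply: leq_trans (mxrank_incl_rat cH le_ek).
rewrite -(map_incl_mx (intr : int -> F)) -(map_incl_mx (intr : int -> rat)).
exact: mxrank_intr.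
Qed.

End Inclusion.

Section Evaluation.

Variables (F : fieldType) (n : nat).

Definition xsupp (m : 'X_{1.. n + n}) : {set 'I_n} := [set i | m (lshift n i) != 0%N].
Definition ysupp (m : 'X_{1.. n + n}) : {set 'I_n} := [set i | m (rshift n i) != 0%N].

Lemma card_supp_mdeg (m : 'X_{1.. n + n}) : (#|xsupp m| + #|ysupp m| <= mdeg m)%N.
Proof.
rewrite mdegE big_split_ord /= -!sum1_card.
by apply: leq_add; rewrite big_mkcond /=; apply: leq_sum => i _;
  rewrite inE; case: (m _).
Qed.

(** At a 0/1 point only the support of a monomial matters, the convention being [0 ^+ 0 = 1]. *)
Lemma prod_charvec (A : {set 'I_n}) (m : 'I_n -> nat) :
  \prod_i charvec F A i ^+ m i = ([set i | m i != 0%N] \subset A)%:R.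
Proof.
have [/subsetP sA|/subsetPn[i]] := boolP (_ \subset A).
  apply: big1 => i _; have := sA i; rewrite inE /charvec.
  by case: (m i) => // l ->; rewrite ?expr1n.
rewrite inE => mi /negPf Ai.
by rewrite (bigD1 i) //= /charvec Ai expr0n (negPf mi) mul0r.
Qed.

Lemma eval2_charvec (P : {mpoly F[n + n]}) (A B : {set 'I_n}) :
  eval2 P (charvec F A) (charvec F B) =
  \sum_(m <- msupp P) P@_m * ((xsupp m \subset A)%:R * (ysupp m \subset B)%:R).
Proof.
rewrite /eval2 mevalE; apply: eq_bigr => m _; congr (_ * _).
rewrite big_split_ord /= -!prod_charvec; congr (_ * _); apply: eq_bigr => i _.
  by rewrite -[lshift n i]/(unsplit (inl i)) unsplitK.
by rewrite -[rshift n i]/(unsplit (inr i)) unsplitK.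
Qed.

Definition eval2_mx (P : {mpoly F[n + n]}) (H : {set {set 'I_n}}) : 'M[F]_#|H| :=
  \matrix_(i, j) eval2 P (charvec F (enum_val i)) (charvec F (enum_val j)).

Lemma mxrank_eval2 (P : {mpoly F[n + n]}) (H : {set {set 'I_n}}) (d : nat) :
  (msize P <= d.+1)%N ->
  (\rank (eval2_mx P H) <=
     2 * \rank (incl_mx F [set S : {set 'I_n} | #|S| <= d %/ 2]%N H))%N.
Proof.
move=> degP; set K := [set S | _]; set W := incl_mx F K H.
pose r := incl_row F H.
(* Each monomial contributes a matrix of rank at most one, a column from its [x]-part times a row
   from its [y]-part. *)
pose term m := P@_m *: ((r (xsupp m))^T *m r (ysupp m)).
have -> : eval2_mx P H = \sum_(m <- msupp P) term m.
  apply/matrixP => i j; rewrite mxE eval2_charvec summxE.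
  by apply: eq_bigr => m _; rewrite !mxE big_ord1 !mxE.
rewrite (bigID (fun m => xsupp m \in K)) /=.
rewrite mul2n -addnn; apply: leq_trans (mxrank_add _ _) _; apply: leq_add.
  (* For small [x]-support, the transposed terms have their rows in the row space of [W]. *)
  rewrite -mxrank_tr; apply: mxrankS; rewrite raddf_sum.
  apply: summx_sub => m Km; rewrite /term /= linearZ /= trmx_mul trmxK.
  by apply/scalemx_sub/mulmx_sub/incl_row_sub.
(* Otherwise [#|xsupp m| > d %/ 2], and the degree bound forces [#|ysupp m| <= d %/ 2]. *)
apply: mxrankS; rewrite big_seq_cond; apply: summx_sub => m /andP[Pm].
rewrite inE => nKm; apply/scalemx_sub/mulmx_sub/incl_row_sub; rewrite inE.
have := leq_trans (msize_mdeg_lt Pm) degP.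
have := card_supp_mdeg m; lia.
Qed.

End Evaluation.

(* [msize P] is one more than the total degree of a nonzero P, and 0 for P = 0. *)
Theorem theorem1p6 (F : fieldType) (n d k : nat) (H : {set {set 'I_n}}) :
  (d <= n)%N ->
  (forall A : {set 'I_n}, A \in H -> #|A| = k) ->
  (exists P : {mpoly F[n + n]},
    [/\ (msize P <= d.+1)%N,
        forall A : {set 'I_n}, A \in H ->
          eval2 P (charvec F A) (charvec F A) != 0
      & forall A B : {set 'I_n}, A \in H -> B \in H -> A <> B ->
          eval2 P (charvec F A) (charvec F B) = 0]) ->
  (#|H| <= 2 * 'C(n, d %/ 2))%N.
Proof.
move=> le_dn cH [P [degP diagP offP]].
have [le_ek|lt_ke] := leqP (d %/ 2) k; last first.
  have sHk : H \subset [set A : {set 'I_n} | #|A| == k].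
    by apply/subsetP => A /cH cA; rewrite inE cA.
  apply: leq_trans (subset_leq_card sHk) _.
  rewrite card_draws card_ord; apply: leq_trans (leq_pmull _ _) => //.
  (* From [d <= n], twice [d %/ 2] is at most [n]. *)
  by apply: leq_bin_half; [exact: ltnW | rewrite -muln2; lia].
have rankM : \rank (eval2_mx P H) = #|H|.
  pose D : 'rV[F]_#|H| := \row_i eval2_mx P H i i.
  have -> : eval2_mx P H = diag_mx D.
    apply/matrixP => i j; rewrite !mxE; case: eqVneq => [-> //|neq_ij].
    by rewrite offP ?enum_valP // => /enum_val_inj/eqP; rewrite (negPf neq_ij).
  apply: mxrank_unit; rewrite unitmxE unitfE det_diag.
  by apply/prodf_neq0 => i _; rewrite !mxE diagP ?enum_valP.
rewrite -rankM; apply: leq_trans (mxrank_eval2 H degP) _.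
by rewrite leq_mul2l /= -[n in 'C(n, _)]card_ord (mxrank_incl F cH).
Qed.
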